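(* Let $\mathbb{T}$ be a time scale, $0\le\alpha\le1$, let $s_0,s\in\mathbb{T}$ with $s_0<s$, let $k\in\mathbb{R}$, and let $f,g:[s_0,s]_{\mathbb{T}}\to\mathcal{F}_N(\mathbb{R})$ be $\diamond_{gH}^\alpha$-integrable. Then: 1. $f+g$ is $\diamond_{gH}^\alpha$-integrable on $[s_0,s]_{\mathbb{T}}$ and $\int_{s_0}^s[f(t)+g(t)]\diamond_{gH}^\alpha t=\int_{s_0}^sf(t)\diamond_{gH}^\alpha t+\int_{s_0}^sg(t)\diamond_{gH}^\alpha t$. 2. $kf$ is $\diamond_{gH}^\alpha$-integrable on $[s_0,s]_{\mathbb{T}}$ and $\int_{s_0}^skf(t)\diamond_{gH}^\alpha t=k\int_{s_0}^sf(t)\diamond_{gH}^\alpha t$. 3. For any $m\in[s_0,s]_{\mathbb{T}}$, $\int_{s_0}^sf(t)\diamond_{gH}^\alpha t=\int_{s_0}^mf(t)\diamond_{gH}^\alpha t+\int_m^sf(t)\diamond_{gH}^\alpha t$.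
   Context: A time scale $\mathbb{T}$ is a nonempty closed subset of $\mathbb{R}$; $[a,b]_{\mathbb{T}}=[a,b]\cap\mathbb{T}$. A fuzzy number is a function $u:\mathbb{R}\to[0,1]$ that is normal ($u(x_0)=1$ for some $x_0$), quasiconcave, upper semicontinuous, and has compact support $\mathrm{cl}\{x:u(x)>0\}$; $\mathcal{F}_N(\mathbb{R})$ is the set of fuzzy numbers. The $r$-level sets are $u_r=[u]_r=\{x:u(x)\ge r\}$ for $0<r\le1$ and $u_0=\mathrm{cl}\{x:u(x)>0\}$; they are compact intervals. Addition and multiplication by real scalars are levelwise: $(u+v)_r=u_r+v_r$, $(cu)_r=c\,u_r$ (interval operations). For a fuzzy function $f$, $f_r(t)=[f(t)]_r$. For real-valued $g$, the diamond-alpha integral is $\int_a^bg(t)\diamond^\alpha t=\alpha\int_a^bg(t)\Delta t+(1-\alpha)\int_a^bg(t)\nabla t$, a convex combination of the usual (Lebesgue) delta and nabla integrals on time scales; $g$ is integrable if both of these exist. A selector of a set-valued map $G$ from $[a,b]_{\mathbb{T}}$ to the nonempty compact convex subsets of $\mathbb{R}$ is a function $g$ with $g(t)\in G(t)$ for all $t$; $S(G)$ is the set of integrable selectors, and $\int_a^bG(t)\diamond_{gH}^\alpha t=\{\int_a^bg(t)\diamond^\alpha t:g\in S(G)\}$. A fuzzy function $f:[a,b]_{\mathbb{T}}\to\mathcal{F}_N(\mathbb{R})$ is (Aumann) $\diamond_{gH}^\alpha$-integrable on $[a,b]_{\mathbb{T}}$ if there is a fuzzy number $u\in\mathcal{F}_N(\mathbb{R})$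 with $[u]_r=\int_a^bf_r(t)\diamond_{gH}^\alpha t$ for all $r\in[0,1]$; then $\int_a^bf(t)\diamond_{gH}^\alpha t:=u$.
   Formalization: Item 1 is proved under the added assumption that the r-level set-valued maps of f, or those of g, are (Lebesgue delta- and nabla-) measurable; without it item 1 fails, e.g. f=[-1_N,1_N], g=[-1_M,1_M] on [0,1] with N and its complement M of inner measure 0. *)

(* Defs.v *)
From HB Require Import structures.
From mathcomp Require Import all_boot all_order all_algebra.
From mathcomp Require Import all_classical all_reals all_analysis.
From mathcomp Require Import ring lra.

Set Implicit Arguments.
Unset Strict Implicit.
Unset Printing Implicit Defensive.

Import Order.TTheory GRing.Theory Num.Theory.
Import numFieldNormedType.Exports.

Local Open Scope classical_set_scope.
Local Open Scope ring_scope.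

Record timeScale (R : realType) := TimeScale {
  points :> set R;
  points_neq0 : points !=set0;
  points_closed : closed points }.

Definition ts_itv (R : realType) (T : timeScale R) (a b : R) : set R :=
  T `&` `[a, b].

(* The usual conventions for the jump of an extremal point are inf set0 = sup T
   and sup set0 = inf T. *)
Definition forward_jump (R : realType) (T : timeScale R) (x : R) : R :=
  if pselect (T `&` `]x, +oo[ !=set0) then inf (T `&` `]x, +oo[) else sup T.

(* The right-continuous modification of the backward jump
   x |-> sup {s in T | s < x}. *)
Definition retract_left (R : realType) (T : timeScale R) (x : R) : R :=
  if pselect (T `&` `]-oo, x] !=set0) then sup (T `&` `]-oo, x]) else inf T.

Section jumps.
Context {R : realType} (T : timeScale R).

Lemma forward_jump_le x s : points T s -> x < s -> forward_jump T x <= s.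
Proof.
move=> Ts xs; rewrite /forward_jump; case: pselect => [?|[]]; last first.
  by exists s; split => //=; rewrite in_itv/= xs.
apply: ge_inf; last by split => //=; rewrite in_itv/= xs.
by exists x => y [_ /=]; rewrite in_itv/= andbT => /ltW.
Qed.

Lemma le_forward_jump x y s :
  points T s -> x < s -> (forall t, points T t -> x < t -> y <= t) ->
  y <= forward_jump T x.
Proof.
move=> Ts xs h; rewrite /forward_jump; case: pselect => [?|[]]; last first.
  by exists s; split => //=; rewrite in_itv/= xs.
apply: lb_le_inf; first by exists s; split => //=; rewrite in_itv/= xs.
by move=> t [Tt /=]; rewrite in_itv/= andbT; exact: h.
Qed.

Lemma forward_jump_cst x :
  (forall t, points T t -> t <= x) -> forward_jump T x = sup T.
Proof.
move=> h; rewrite /forward_jump; case: pselect => //= -[t [/h tx /=]].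
by rewrite in_itv/= andbT ltNge tx.
Qed.

Lemma forward_jump_nd : nondecreasing (forward_jump T).
Proof.
move=> x y xy.
have [[t Tt yt]|h] := pselect (exists2 t, points T t & y < t).
  apply: (le_forward_jump Tt yt) => s Ts ys.
  by apply: forward_jump_le => //; exact: le_lt_trans ys.
have hy t : points T t -> t <= y.
  by move=> Tt; rewrite leNgt; apply/negP => ?; apply: h; exists t.
rewrite (forward_jump_cst hy).
have [[t Tt xt]|h'] := pselect (exists2 t, points T t & x < t).
  apply: (le_trans (forward_jump_le Tt xt)).
  by apply: ub_le_sup => //; exists y.
by rewrite forward_jump_cst// => t Tt; rewrite leNgt; apply/negP => ?; apply: h'; exists t.
Qed.

Lemma forward_jump_rc : right_continuous (forward_jump T).
Proof.
move=> x; have nd := forward_jump_nd.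
have [[t Tt xt]|h] := pselect (exists2 t, points T t & x < t); last first.
  have hx t : points T t -> t <= x.
    by move=> Tt; rewrite leNgt; apply/negP => ?; apply: h; exists t.
  apply/cvgrPdist_le => e e0; near=> y.
  rewrite !forward_jump_cst ?subrr ?normr0 ?ltW// => s /hx /le_trans; apply.
  by apply: ltW; near: y; exact: nbhs_right_gt.
apply/cvgrPdist_lt => e e0.
have [s [Ts xs] se] : exists2 s, points T s /\ x < s & s < forward_jump T x + e.
  have [//|h] := pselect (exists2 s, points T s /\ x < s & s < forward_jump T x + e).
  have : forward_jump T x + e <= forward_jump T x.
    apply: (le_forward_jump Tt xt) => s Ts xs; rewrite leNgt.
    by apply/negP => ?; apply: h; exists s.
  by rewrite gerDl leNgt e0.
near=> y.
have xy : x < y by near: y; exact: nbhs_right_gt.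
have ys : y < s by near: y; exact: nbhs_right_lt.
have h1 := nd _ _ (ltW xy).
have h2 := forward_jump_le Ts ys.
by rewrite distrC ger0_norm ?subr_ge0// ltrBlDl; exact: le_lt_trans se.
Unshelve. all: by end_near. Qed.

HB.instance Definition _ := isCumulative.Build R _ R (forward_jump T)
  forward_jump_nd forward_jump_rc.

Lemma le_retract_left x s : points T s -> s <= x -> s <= retract_left T x.
Proof.
move=> Ts xs; rewrite /retract_left; case: pselect => [?|[]]; last first.
  by exists s; split => //=; rewrite in_itv.
apply: ub_le_sup; last by split => //=; rewrite in_itv.
by exists x => y [_ /=]; rewrite in_itv.
Qed.

Lemma retract_left_le x y s :
  points T s -> s <= x -> (forall t, points T t -> t <= x -> t <= y) ->
  retract_left T x <= y.
Proof.
move=> Ts xs h; rewrite /retract_left; case: pselect => [?|[]]; last first.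
  by exists s; split => //=; rewrite in_itv.
apply: ge_sup; first by exists s; split => //=; rewrite in_itv.
by move=> t [Tt /=]; rewrite in_itv/=; exact: h.
Qed.

Lemma retract_left_cst x :
  (forall t, points T t -> x < t) -> retract_left T x = inf T.
Proof.
move=> h; rewrite /retract_left; case: pselect => //= -[t [/h tx /=]].
by rewrite in_itv/= leNgt tx.
Qed.

Lemma retract_left_id x : points T x -> retract_left T x = x.
Proof.
move=> Tx; apply/eqP; rewrite eq_le le_retract_left ?andbT//.
exact: (retract_left_le Tx).
Qed.

Lemma retract_left_nd : nondecreasing (retract_left T).
Proof.
move=> x y xy.
have [[t Tt yt]|h] := pselect (exists2 t, points T t & t <= x).
  apply: (retract_left_le Tt yt) => s Ts ys.
  by apply: le_retract_left => //; exact: le_trans xy.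
have hy t : points T t -> x < t.
  by move=> Tt; rewrite ltNge; apply/negP => ?; apply: h; exists t.
rewrite (retract_left_cst hy).
have [[t Tt xt]|h'] := pselect (exists2 t, points T t & t <= y).
  apply: (le_trans _ (le_retract_left Tt xt)).
  by apply: ge_inf => //; exists x => s /hy/ltW.
by rewrite retract_left_cst// => t Tt; rewrite ltNge; apply/negP => ?; apply: h'; exists t.
Qed.

Lemma retract_left_rc : right_continuous (retract_left T).
Proof.
move=> x; have nd := retract_left_nd.
have [Tx|nTx] := pselect (points T x).
  apply/cvgrPdist_le => e e0; near=> y.
  have xy : x < y by near: y; exact: nbhs_right_gt.
  have h1 := nd _ _ (ltW xy).
  rewrite distrC ger0_norm ?subr_ge0// lerBlDl.
  apply: (retract_left_le Tx (ltW xy)) => t Tt ty; apply: (le_trans ty).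
  rewrite retract_left_id//; apply: ltW.
  by near: y; apply: nbhs_right_lt; rewrite ltrDl.
have /nbhs_ballP[d/= d0 hd] : nbhs x (~` T).
  by apply: open_nbhs_nbhs; split => //; exact/closed_openC/points_closed.
have gap y t : x < y -> y < x + d -> points T t -> t <= y -> t <= x.
  move=> xy yd Tt ty; rewrite leNgt; apply/negP => xt.
  apply: (hd t) => //; rewrite /ball/= distrC ger0_norm ?subr_ge0 1?ltW//.
  by rewrite ltrBlDl; exact: le_lt_trans yd.
apply/cvgrPdist_le => e e0; near=> y.
have xy : x < y by near: y; exact: nbhs_right_gt.
have yd : y < x + d by near: y; apply: nbhs_right_lt; rewrite ltrDl.
suff -> : retract_left T y = retract_left T x by rewrite subrr normr0 ltW.
have [[t Tt tx]|h] := pselect (exists2 t, points T t & t <= x).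
  apply/eqP; rewrite eq_le; apply/andP; split; last exact: nd (ltW xy).
  apply: (retract_left_le Tt (le_trans tx (ltW xy))) => s Ts sy.
  by apply: le_retract_left => //; exact: gap sy.
rewrite !retract_left_cst// => t Tt; rewrite ltNge; apply/negP => ty; apply: h.
  by exists t.
by exists t => //; exact: gap ty.
Unshelve. all: by end_near. Qed.

HB.instance Definition _ := isCumulative.Build R _ R (retract_left T)
  retract_left_nd retract_left_rc.

End jumps.

(* The Lebesgue Delta-measure is the Caratheodory extension of
   [c, d[ |-> d - c, and the Lebesgue nabla-measure that of ]c, d] |-> d - c,
   for c <= d in T (see delta_measure_itv and nabla_measure_itv). As measures on
   the line concentrated on T they are the completed Stieltjes measures
   of the forward jump and of the left retraction. *)
Section time_scale_measures.
Context {R : realType} (T : timeScale R).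

Definition delta_measure := completed_lebesgue_stieltjes_measure (forward_jump T).
Definition nabla_measure := completed_lebesgue_stieltjes_measure (retract_left T).

HB.instance Definition _ := Measure.on delta_measure.
HB.instance Definition _ := Measure.on nabla_measure.

Lemma nabla_measure_itv c d : points T c -> points T d -> c <= d ->
  nabla_measure `]c, d] = (d - c)%:E.
Proof.
move=> Tc Td cd; rewrite /nabla_measure /completed_lebesgue_stieltjes_measure.
rewrite /completed_measure_extension measurable_mu_extE; last exact: is_ocitv.
by rewrite /= wlength_itv_bnd// !retract_left_id.
Qed.

Lemma delta_measure_set1 c : points T c ->
  delta_measure [set c] = (forward_jump T c - c)%:E.
Proof.
move=> Tc.
pose A (n : nat) : set R := `]c - n.+1%:R^-1, c]%classic.
have mA n : measurable (A n : set (caratheodory_type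
    ((wlength (forward_jump T))^*)%mu)).
  by apply: sub_caratheodory; apply: sub_sigma_algebra; exact: is_ocitv.
have muA n : delta_measure (A n) =
    (forward_jump T c - forward_jump T (c - n.+1%:R^-1))%:E.
  rewrite /delta_measure /completed_lebesgue_stieltjes_measure.
  rewrite /completed_measure_extension measurable_mu_extE; last exact: is_ocitv.
  by rewrite /= wlength_itv_bnd// lerBlDr lerDl.
have bigA : \bigcap_n A n = [set c].
  by rewrite set1_bigcap_oc.
have : delta_measure \o A @ \oo --> delta_measure (\bigcap_n A n).
  apply: nonincreasing_cvg_mu => //.
  - have : (delta_measure (A 0%N) < +oo)%E by rewrite muA ltry.
    exact.
  - by apply: bigcap_measurable.
  - move=> m n mn; apply/subsetPset => x; rewrite /A/= !in_itv/= => /andP[h ->].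
    rewrite andbT; apply: le_lt_trans h; rewrite lerB//.
    by rewrite lef_pV2 ?posrE// ler_nat ltnS.
rewrite bigA => /cvg_lim <-//; apply/cvg_lim => //.
have -> : delta_measure \o A =
    EFin \o (fun n : nat => forward_jump T c - forward_jump T (c - n.+1%:R^-1)).
  by apply/funext => n /=; rewrite muA.
apply: cvg_EFin; first by near=> n.
apply: cvgB; first exact: cvg_cst.
apply: (@squeeze_cvgr _ _ _ _ (fun n : nat => c - n.+1%:R^-1) (fun=> c)).
- near=> n; have cn : c - n.+1%:R^-1 < c by rewrite ltrBlDr ltrDl.
  rewrite (forward_jump_le Tc cn) andbT; apply: (le_forward_jump Tc cn).
  by move=> t _ /ltW.
- rewrite -[X in _ --> X]subr0; apply: cvgB; first exact: cvg_cst.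
  exact: cvg_harmonic.
- exact: cvg_cst.
Unshelve. all: by end_near. Qed.

Lemma delta_measure_itv c d : points T c -> points T d -> c <= d ->
  delta_measure `[c, d[ = (d - c)%:E.
Proof.
move=> Tc Td; rewrite le_eqVlt => /predU1P[->|cd].
  by rewrite set_itvco0 measure0 subrr.
have moc a b : measurable (`]a, b]%classic : set (caratheodory_type
    ((wlength (forward_jump T))^*)%mu)).
  by apply: sub_caratheodory; apply: sub_sigma_algebra; exact: is_ocitv.
have m1 a : measurable ([set a] : set (caratheodory_type
    ((wlength (forward_jump T))^*)%mu)).
  apply: sub_caratheodory; exact: (measurable_set1 a).
have moo : measurable (`]c, d[%classic : set (caratheodory_type
    ((wlength (forward_jump T))^*)%mu)).
  by rewrite -(setDitv1r _ _ false); exact: measurableD.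
have e1 : delta_measure `[c, d[ = (delta_measure [set c] + delta_measure `]c, d[)%E.
  rewrite -(setU1itv false)//= measureU//.
  by apply/seteqP; split => // x [] /= ->; rewrite in_itv/= ltxx.
have e2 : delta_measure `]c, d] = (delta_measure `]c, d[ + delta_measure [set d])%E.
  rewrite -(setUitv1 true)//= measureU//.
  by apply/seteqP; split => // x [] /= + xd; rewrite in_itv/= xd ltxx andbF.
have e3 : delta_measure `]c, d] = (forward_jump T d - forward_jump T c)%:E.
  rewrite /delta_measure /completed_lebesgue_stieltjes_measure.
  rewrite /completed_measure_extension measurable_mu_extE; last exact: is_ocitv.
  by rewrite /= wlength_itv_bnd// ltW.
move: e2; rewrite e1 e3 !delta_measure_set1//.
case: (delta_measure `]c, d[) => [r| |]//=.
rewrite -!EFinD => -[h]; congr EFin; lra.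
Qed.

End time_scale_measures.
Arguments delta_measure {R} T.
Arguments nabla_measure {R} T.

Section diamond_integral.
Context {R : realType} (T : timeScale R) (alpha a b : R).

Definition diamond_integrable (g : R -> R) : Prop :=
  (delta_measure T).-integrable (T `&` `[a, b[) (EFin \o g) /\
  (nabla_measure T).-integrable (T `&` `]a, b]) (EFin \o g).

Definition diamond_integral (g : R -> R) : R :=
  alpha * \int[delta_measure T]_(t in T `&` `[a, b[) g t +
  (1 - alpha) * \int[nabla_measure T]_(t in T `&` `]a, b]) g t.

Definition selector (G : R -> set R) (g : R -> R) : Prop :=
  forall t, ts_itv T a b t -> G t (g t).

Definition set_diamond_integral (G : R -> set R) : set R :=
  [set diamond_integral g | g in
    [set g | selector G g /\ diamond_integrable g]].

End diamond_integral.

Record fuzzyNumber (R : realType) := FuzzyNumber {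
  membership :> R -> R;
  membership_itv : forall x, 0 <= membership x <= 1;
  membership_normal : exists x, membership x = 1;
  membership_quasiconcave : forall x y l, 0 <= l <= 1 ->
    Num.min (membership x) (membership y) <= membership (l * x + (1 - l) * y);
  membership_usc : forall x a, membership x < a ->
    \forall y \near x, membership y < a;
  membership_compact : compact (closure [set x | 0 < membership x]) }.

Definition level (R : realType) (u : fuzzyNumber R) (r : R) : set R :=
  if r == 0 then closure [set x | 0 < u x] else [set x | r <= u x].

(* The conditions under which a family A of subsets of the line, indexed
   by [0, 1], is the family of levels of a fuzzy number. *)
Record level_family (R : realType) (A : R -> set R) : Prop := LevelFamily {
  lf_neq0 : A 1 !=set0;
  lf_antitone : forall r s, 0 <= r -> r <= s -> s <= 1 -> A s `<=` A r;
  lf_convex : forall r x y l, 0 <= r <= 1 -> A r x -> A r y -> 0 <= l <= 1 ->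
    A r (l * x + (1 - l) * y);
  lf_compact : forall r, 0 <= r <= 1 -> compact (A r);
  lf_left : forall r x, 0 < r <= 1 -> (forall s, 0 < s < r -> A s x) -> A r x;
  lf_zero : A 0 `<=` closure (\bigcup_(r in `]0, 1]%classic) A r) }.

(* The value is 0 where no level contains x, by sup set0 = 0. *)
Definition membership_of_levels (R : realType) (A : R -> set R) (x : R) : R :=
  sup [set r | 0 <= r <= 1 /\ A r x].

Section fuzzy_of_levels.
Context {R : realType} (A : R -> set R) (hA : level_family A).
Let u := membership_of_levels A.

Lemma membership_of_levels_ge r x : 0 < r <= 1 -> (r <= u x) <-> A r x.
Proof.
move=> /andP[r0 r1]; rewrite /u /membership_of_levels; set E := [set r | _].
have ubE : has_ubound E by exists 1 => s [/andP[]].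
split => [rE|Arx]; last by apply: ub_le_sup => //; split => //; rewrite ltW.
apply: (lf_left hA) => [|s /andP[s0 sr]]; first by rewrite r0.
have E0 : E !=set0.
  apply/set0P/eqP => E0; move: rE; rewrite E0 sup0 leNgt r0 //.
have [|t [/andP[t0 t1] At] st] := @sup_adherent _ E (sup E - s) _ (conj E0 ubE).
  by rewrite subr_gt0; exact: lt_le_trans rE.
by apply: (lf_antitone hA) At => //; [exact: ltW|rewrite subKr in st; exact: ltW].
Qed.

Lemma membership_of_levels_itv x : 0 <= u x <= 1.
Proof.
rewrite /u /membership_of_levels; set E := [set r | _].
have [->|/set0P[r Er]] := eqVneq E set0; first by rewrite sup0 lexx ler01.
have ubE : ubound E 1 by move=> s [/andP[]].
apply/andP; split; last by apply: ge_sup => //; exists r.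
have /andP[r0 _] := Er.1.
by apply: (le_trans r0); apply: ub_le_sup => //; exists 1.
Qed.

Lemma membership_of_levels_gt0 x :
  0 < u x <-> (\bigcup_(r in `]0, 1]%classic) A r) x.
Proof.
have /andP[u0 u1] := membership_of_levels_itv x; split => [ux|[r /=]].
  exists (u x); first by rewrite /= in_itv/= ux.
  by apply/membership_of_levels_ge; rewrite ?ux.
rewrite in_itv/= => r01 /membership_of_levels_ge h.
by apply: lt_le_trans (h r01); case/andP: r01.
Qed.

Lemma membership_of_levels_level r : 0 <= r <= 1 ->
  (if r == 0 then closure [set x | 0 < u x] else [set x | r <= u x]) = A r.
Proof.
move=> /andP[r0 r1]; case: ifPn => [/eqP ->|rN0]; last first.
  apply/seteqP; split => x /=; have h : 0 < r <= 1 by rewrite lt_neqAle eq_sym rN0 r0.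
    by move/(membership_of_levels_ge x h).
  by move/(membership_of_levels_ge x h).
have -> : [set x | 0 < u x] = \bigcup_(r in `]0, 1]%classic) A r.
  by apply/seteqP; split => x /= /membership_of_levels_gt0.
apply/seteqP; split; last exact: lf_zero.
have cA : closed (A 0).
  by apply: compact_closed; [exact: Rhausdorff|apply: (lf_compact hA); rewrite lexx ler01].
rewrite closure_id in cA; rewrite [X in _ `<=` X]cA; apply: closureS.
move=> x [s /=]; rewrite in_itv/= => /andP[s0 s1].
by apply: (lf_antitone hA) => //; exact: ltW.
Qed.

Lemma membership_of_levels_normal : exists x, u x = 1.
Proof.
have [x Ax] := lf_neq0 hA; exists x; apply/eqP; rewrite eq_le.
have /andP[_ ->] /= := membership_of_levels_itv x.
by apply/membership_of_levels_ge; rewrite ?ltr01 ?lexx.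
Qed.

Lemma membership_of_levels_quasiconcave x y l : 0 <= l <= 1 ->
  Num.min (u x) (u y) <= u (l * x + (1 - l) * y).
Proof.
move=> l01; set m := Num.min _ _.
have /andP[w0 w1] := membership_of_levels_itv (l * x + (1 - l) * y).
have [m0|m0] := leP m 0; first exact: le_trans w0.
have m1 : m <= 1.
  by rewrite /m ge_min; have /andP[_ ->] := membership_of_levels_itv x.
have m01 : 0 < m <= 1 by rewrite m0.
apply/membership_of_levels_ge => //; apply: (lf_convex hA) => //.
- by rewrite ltW.
- by apply/membership_of_levels_ge => //; rewrite /m ge_min lexx.
- by apply/membership_of_levels_ge => //; rewrite /m ge_min lexx orbT.
Qed.

Lemma membership_of_levels_usc x a : u x < a -> \forall y \near x, u y < a.
Proof.
move=> xa; have /andP[ux0 _] := membership_of_levels_itv x.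
have [a1|a1] := ltP 1 a.
  apply: (@nearW _ (nbhs x)) => y; have /andP[_ h] := membership_of_levels_itv y.
  exact: le_lt_trans a1.
have a01 : 0 < a <= 1 by rewrite (le_lt_trans ux0).
have cA : closed (A a).
  apply: compact_closed; first exact: Rhausdorff.
  by apply: (lf_compact hA); rewrite a1 ltW// (le_lt_trans ux0).
have : nbhs x (~` A a).
  apply: open_nbhs_nbhs; split; first exact: closed_openC.
  by move/(membership_of_levels_ge x a01); rewrite leNgt xa.
by apply: (@filterS _ (nbhs x)) => y /= hy; rewrite ltNge; apply/negP => /(membership_of_levels_ge y a01).
Qed.

Lemma membership_of_levels_compact : compact (closure [set x | 0 < u x]).
Proof.
have := @membership_of_levels_level 0; rewrite eqxx lexx ler01 => -> //.
by apply: (lf_compact hA); rewrite lexx ler01.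
Qed.

Definition fuzzy_of_levels : fuzzyNumber R :=
  FuzzyNumber membership_of_levels_itv membership_of_levels_normal
    membership_of_levels_quasiconcave membership_of_levels_usc
    membership_of_levels_compact.

Lemma level_fuzzy_of_levels r : 0 <= r <= 1 -> level fuzzy_of_levels r = A r.
Proof. exact: membership_of_levels_level. Qed.

End fuzzy_of_levels.

Section levels.
Context {R : realType}.
Implicit Types u v : fuzzyNumber R.

Lemma level_gt0 u r : 0 < r -> level u r = [set x | r <= u x].
Proof. by rewrite /level => /gt_eqF ->. Qed.

Lemma level_bigcup u : [set x | 0 < u x] = \bigcup_(r in `]0, 1]%classic) level u r.
Proof.
apply/seteqP; split => [x /= ux|x [r /=]].
  exists (u x); last by rewrite level_gt0//=.
  by rewrite /= in_itv/= ux; case/andP: (membership_itv u x).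
by rewrite in_itv/= => /andP[r0 _]; rewrite level_gt0//=; exact: lt_le_trans.
Qed.

Lemma level0 u : level u 0 = closure (\bigcup_(r in `]0, 1]%classic) level u r).
Proof. by rewrite -level_bigcup /level eqxx. Qed.

Lemma level_sub0 u r : 0 < r -> level u r `<=` level u 0.
Proof.
move=> r0 x; rewrite level_gt0// /level eqxx => /= rx.
by apply: subset_closure => /=; exact: lt_le_trans rx.
Qed.

Lemma level_closed u r : 0 <= r -> closed (level u r).
Proof.
rewrite le_eqVlt => /predU1P[<-|r0].
  by rewrite /level eqxx; exact: closed_closure.
move=> x cx; rewrite level_gt0//= leNgt; apply/negP => xr.
have [y [uy yr]] := cx _ (membership_usc xr).
by move: uy; rewrite level_gt0//= leNgt yr.
Qed.

Lemma level_compact u r : 0 <= r -> compact (level u r).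
Proof.
rewrite le_eqVlt => /predU1P[<-|r0].
  by rewrite /level eqxx; exact: membership_compact.
apply: (@subclosed_compact _ _ (level u 0)).
- by apply: level_closed; exact: ltW.
- by rewrite /level eqxx; exact: membership_compact.
- exact: level_sub0.
Qed.

Lemma level_antitone u r s : 0 <= r -> r <= s -> level u s `<=` level u r.
Proof.
rewrite le_eqVlt => /predU1P[<-|r0 rs].
  by rewrite le_eqVlt => /predU1P[<-//|]; exact: level_sub0.
rewrite !level_gt0//; last exact: lt_le_trans rs.
by move=> x /=; exact: le_trans.
Qed.

Lemma level_convex u r x y l : 0 <= r -> level u r x -> level u r y ->
  0 <= l <= 1 -> level u r (l * x + (1 - l) * y).
Proof.
rewrite le_eqVlt => /predU1P[<-|r0]; last first.
  rewrite !level_gt0//= => rx ry l01.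
  by apply: le_trans (membership_quasiconcave u x y l01); rewrite le_min rx.
rewrite /level eqxx => hx hy l01 B /nbhs_ballP[e/= e0 hB].
have [x' [/= ux' bx]] := hx _ (nbhsx_ballx x e e0).
have [y' [/= uy' by_]] := hy _ (nbhsx_ballx y e e0).
exists (l * x' + (1 - l) * y'); split => /=.
  apply: lt_le_trans (membership_quasiconcave u x' y' l01).
  by rewrite lt_min ux'.
apply: hB; move: bx by_; rewrite /ball/= => bx by_.
have /andP[l0 l1] := l01.
rewrite (_ : _ - _ = l * (x - x') + (1 - l) * (y - y')); last by ring.
apply: (le_lt_trans (ler_normD _ _)); rewrite !normrM (ger0_norm l0).
rewrite (@ger0_norm _ (1 - l)) ?subr_ge0//.
move: bx by_; set p := `|_|; set q := `|_| => bx by_.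
have [->|l0'] := eqVneq l 0; first by rewrite mul0r subr0 mul1r add0r.
have : l * p < l * e by rewrite ltr_pM2l// lt_neqAle eq_sym l0'.
have : (1 - l) * q <= (1 - l) * e by rewrite ler_wpM2l ?subr_ge0// ltW.
lra.
Qed.

Lemma level_left u r x : 0 < r -> (forall s, 0 < s < r -> level u s x) ->
  level u r x.
Proof.
move=> r0 h; rewrite level_gt0//= leNgt; apply/negP => ur.
have u0 : 0 <= u x by case/andP: (membership_itv u x).
pose s := (u x + r) / 2.
have : level u s x by apply: h; rewrite /s; lra.
by rewrite level_gt0 /s/=; lra.
Qed.

Lemma level_neq0 u : level u 1 !=set0.
Proof.
by have [x ux] := membership_normal u; exists x; rewrite level_gt0//= ux.
Qed.

Lemma level_familyP u : level_family (level u).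
Proof.
split.
- exact: level_neq0.
- by move=> r s r0 rs _; exact: level_antitone.
- by move=> r x y l /andP[r0 _]; exact: level_convex.
- by move=> r /andP[r0 _]; exact: level_compact.
- by move=> r x /andP[r0 _]; exact: level_left.
- by rewrite level0.
Qed.

Lemma fuzzyNumber_ext u v :
  (forall r, 0 <= r <= 1 -> level u r = level v r) -> u = v.
Proof.
move=> h; have uv : membership u = membership v.
  have le a b : (forall r, 0 <= r <= 1 -> level a r = level b r) ->
      forall x, a x <= b x :> R.
    move=> ab x; have /andP[a0 a1] := membership_itv a x.
    move: a0; rewrite le_eqVlt => /predU1P[<-|a0].
      by case/andP: (membership_itv b x).
    have : level a (a x) x by rewrite level_gt0/=.
    by rewrite ab ?(ltW a0)// level_gt0.
  apply/funext => x; apply/eqP; rewrite eq_le !le// => r r01.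
  by rewrite h.
case: u v uv {h} => [u ? ? ? ? ?] [v ? ? ? ? ?] /= uv; subst v.
congr FuzzyNumber; exact: Prop_irrelevance.
Qed.

End levels.

Section fuzzy_operations.
Context {R : realType}.
Implicit Types u v : fuzzyNumber R.

Definition add_levels u v (r : R) : set R :=
  [set x + y | x in level u r & y in level v r].

Definition scale_levels (k : R) u (r : R) : set R :=
  [set k * x | x in level u r].

Lemma add_level_family u v : level_family (add_levels u v).
Proof.
split.
- have [x ux] := level_neq0 u; have [y vy] := level_neq0 v.
  by exists (x + y), x => //; exists y.
- move=> r s r0 rs _ _ [x ux [y vy <-]].
  exists x; first exact: level_antitone ux.
  by exists y => //; exact: level_antitone vy.
- move=> r _ _ l /andP[r0 _] [x ux [y vy <-]] [x' ux' [y' vy' <-]] l01.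
  exists (l * x + (1 - l) * x'); first exact: level_convex.
  exists (l * y + (1 - l) * y'); first exact: level_convex.
  by ring.
- move=> r /andP[r0 _].
  have -> : add_levels u v r = (fun z : R * R => z.1 + z.2) @` (level u r `*` level v r).
    apply/seteqP; split => [_ [x ux [y vy <-]]|_ [[x y] [/= ux vy] <-]].
      by exists (x, y).
    by exists x => //; exists y.
  apply: continuous_compact; last by apply: compact_setX; exact: level_compact.
  apply: continuous_subspaceT => z.
  by apply: cvgD; [exact: cvg_fst|exact: cvg_snd].
- move=> r x /andP[r0 _] h.
  have /choice[f hf] : forall s, exists y, 0 < s < r -> level u s y /\ level v s (x - y).
    move=> s; have [s0r|] := boolP (0 < s < r); last by exists 0.
    have [y uy [z vz <-]] := h _ s0r.
    by exists y => _; split => //; rewrite addrC addKr.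
  have [|p [_ clp]] := @level_compact _ u 0 (lexx _) (f @ r^'-) _.
    change (\forall s \near r^'-, level u 0 (f s)).
    near=> s; have s0 : 0 < s by near: s; exact: nbhs_left_gt.
    apply: (level_sub0 s0); apply: (hf s _).1; rewrite s0/=.
    by near: s; exact: nbhs_left_lt.
  have inp s : 0 < s < r -> level u s p /\ level v s (x - p).
    move=> /andP[s0 sr].
    have C1 : closed (level u s) by apply: level_closed; exact: ltW.
    have C2 : closed [set y | level v s (x - y)].
      apply: (@preimage_closed _ _ (fun y => x - y)); last by apply: level_closed; exact: ltW.
      by move=> y _; apply: cvgB; [exact: cvg_cst|exact: cvg_id].
    have Cnear : (f @ r^'-) (level u s `&` [set y | level v s (x - y)]).
      change (\forall t \near r^'-, level u s (f t) /\ level v s (x - f t)).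
      near=> t; have st : s < t by near: t; exact: nbhs_left_gt.
      have tr : t < r by near: t; exact: nbhs_left_lt.
      have t0r : 0 < t < r by rewrite tr (lt_trans s0).
      have [h1 h2] := hf t t0r.
      split; first by apply: level_antitone h1; exact: ltW.
      by apply: level_antitone h2; exact: ltW.
    have := closedI C1 C2; apply => B nB; have [y [yl yB]] := clp _ _ Cnear nB.
    by exists y.
  exists p; first by apply: level_left => // s /inp[].
  by exists (x - p); [apply: level_left => // s /inp[]|rewrite subrKC].
- move=> _ [x ux [y vy <-]] B /nbhs_ballP[e/= e0 hB].
  have e20 : 0 < e / 2 by rewrite divr_gt0.
  move: ux vy; rewrite !level0 => ux vy.
  have [x' [[r /= r01 ux'] bx]] := ux _ (nbhsx_ballx x _ e20).
  have [y' [[s /= s01 vy'] by_]] := vy _ (nbhsx_ballx y _ e20).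
  move: r01 s01; rewrite !in_itv/= => /andP[r0 r1] /andP[s0 s1].
  have m0 : 0 < Num.min r s by rewrite lt_min r0.
  exists (x' + y'); split.
    exists (Num.min r s); first by rewrite /= in_itv/= m0 ge_min r1.
    exists x'; first by apply: level_antitone ux'; [exact: ltW|rewrite ge_min lexx].
    exists y' => //; apply: level_antitone vy'; first exact: ltW.
    by rewrite ge_min lexx orbT.
  apply: hB; move: bx by_; rewrite /ball/= => bx by_.
  rewrite (_ : _ - _ = (x - x') + (y - y')); last by ring.
  by apply: (le_lt_trans (ler_normD _ _)); rewrite [e]splitr ltrD.
Unshelve. all: by end_near. Qed.

Lemma scale_level_family k u : level_family (scale_levels k u).
Proof.
split.
- by have [x ux] := level_neq0 u; exists (k * x), x.
- by move=> r s r0 rs _ _ [x ux <-]; exists x => //; exact: level_antitone ux.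
- move=> r _ _ l /andP[r0 _] [x ux <-] [y uy <-] l01.
  by exists (l * x + (1 - l) * y); [exact: level_convex|ring].
- move=> r /andP[r0 _]; apply: continuous_compact; last exact: level_compact.
  by apply: continuous_subspaceT => z; apply: cvgM; [exact: cvg_cst|exact: cvg_id].
- move=> r x /andP[r0 r1] h; have [k0|kN0] := eqVneq k 0.
    have [|y _ yx] := h (r / 2); first by lra.
    have [z uz] := level_neq0 u; exists z; first by apply: level_antitone uz; rewrite // ltW.
    by rewrite -yx k0 !mul0r.
  exists (k^-1 * x); last by rewrite mulVKf.
  by apply: level_left => // s /h [y uy <-]; rewrite mulKf.
- move=> _ [x + <-]; rewrite level0 => ux B.
  have ck : {for x, continuous ( *%R k)}.
    by apply: cvgM; [exact: cvg_cst|exact: cvg_id].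
  move=> /ck /ux[y [[r r01 uy] By]]; exists (k * y); split => //.
  by exists r => //; exists y.
Qed.

Definition fuzzy_add u v : fuzzyNumber R := fuzzy_of_levels (add_level_family u v).

Definition fuzzy_scale (k : R) u : fuzzyNumber R :=
  fuzzy_of_levels (scale_level_family k u).

Lemma level_add u v r : 0 <= r <= 1 ->
  level (fuzzy_add u v) r = [set x + y | x in level u r & y in level v r].
Proof. exact: level_fuzzy_of_levels. Qed.

Lemma level_scale k u r : 0 <= r <= 1 ->
  level (fuzzy_scale k u) r = [set k * x | x in level u r].
Proof. exact: level_fuzzy_of_levels. Qed.

End fuzzy_operations.

Section fuzzy_integral.
Context {R : realType} (T : timeScale R) (alpha a b : R).
Implicit Types f : R -> fuzzyNumber R.

(* A fuzzy function on [a, b]_T is encoded by a total function, of which only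
   the values on [a, b]_T matter. *)
Definition is_fuzzy_integral f (u : fuzzyNumber R) : Prop :=
  forall r, 0 <= r <= 1 ->
    level u r = set_diamond_integral T alpha a b (fun t => level (f t) r).

Definition fuzzy_integrable f : Prop := exists u, is_fuzzy_integral f u.

(* The value is irrelevant when f is not integrable. *)
Definition fuzzy_integral f : fuzzyNumber R :=
  if pselect (fuzzy_integrable f) is left h then projT1 (cid h) else f a.

Lemma fuzzy_integralP f u :
  is_fuzzy_integral f u <-> fuzzy_integrable f /\ fuzzy_integral f = u.
Proof.
rewrite /fuzzy_integral; split => [h|[+ <-]]; case: pselect => //; last first.
- by move=> h _; exact: projT2 (cid h).
- by case; exists u.
move=> h'; split => //; apply: fuzzyNumber_ext => r r01.
by rewrite (projT2 (cid h')) // h.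
Qed.

(* Effros measurability, for the Lebesgue Delta- and nabla-sigma-algebras, of
   the levels of f. Integrability does not imply it, and without it the
   Aumann integral is not additive: if N and its complement M in [0, 1] have
   inner measure 0, the maps t |-> [- 1_N t, 1_N t] and t |-> [- 1_M t, 1_M t]
   have integral {0}, whereas their sum has integral [-1, 1]. *)
Definition levels_measurable f : Prop :=
  forall r (U : set R), 0 <= r <= 1 -> open U ->
    let E := [set t | ts_itv T a b t /\ level (f t) r `&` U !=set0] in
    (wlength (forward_jump T))^*%mu.-cara.-measurable E /\
    (wlength (retract_left T))^*%mu.-cara.-measurable E.

End fuzzy_integral.

(* Main.v *)
Require Import Defs.
From HB Require Import structures.
From mathcomp Require Import all_boot all_order all_algebra.
From mathcomp Require Import all_classical all_reals all_analysis.
From mathcomp Require Import measurable_realfun ring lra.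

(** Everything is proved level by level: for fixed [r] the maps
[t |-> level (f t) r] take compact intervals as values, and the claims become
identities between Aumann integrals of interval-valued maps, in which the
inclusion of the sum of the integrals in the integral comes from operating on
selectors. What needs an idea is the following.

Additivity in the integrand: an integrable selector [h] of [F + G] has to be
decomposed into integrable selectors of [F] and of [G], where only [F] has
measurable endpoints [p <= q]. Nonemptiness of the integral of [G] provides some
integrable selector [psi] of [G]. Truncate [h - psi] to [[p, q]]: this gives a
measurable selector [u] of [F], and [h - u] is a selector of [G]. Indeed
where the truncation does nothing, [h - u = psi]; where it acts, it
moves [h - u] from [psi] towards the [G]-component of any decomposition of [h]
without passing it ([clamp_sub_convex]). Integrability of [u] follows by comparison
with an integrable selector of [F], since truncation does not increase the
distance to points of [[p, q]] (lemma [set_diamond_integralD]).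

Additivity in the interval: selectors on [[a, m]] and [[m, b]] may disagree at
[m], and both values can count, as [m] is charged by the nabla-measure on the
left piece and by the Delta-measure on the right piece. By convexity one may
use at [m] the mean of the two values, weighted by the diamond integrals of the
indicator of [m] over the two pieces (lemma [set_diamond_integral_split]).

Integrability on the subintervals: that the integrals over [[a, m]] form the
levels of a fuzzy number is a fact on the line: if the Minkowski sums of two
decreasing families of convex sets form the levels of a fuzzy number, then
so does each of the two families. The extremal points of a sum are
sums of extremal points, so each summand inherits compactness, continuity
from the left and density at level 0 (lemma [summand_level_family]). *)

Set Implicit Arguments.
Unset Strict Implicit.
Unset Printing Implicit Defensive.

Import Order.TTheory GRing.Theory Num.Theory.
Import numFieldNormedType.Exports.

Local Open Scope classical_set_scope.
Local Open Scope ring_scope.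

(** * Convex subsets of the line *)

Section convex_sets.
Context {R : realType}.
Implicit Types (A B : set R) (p q x y : R).

Definition convex_subset A : Prop :=
  forall x y l, A x -> A y -> 0 <= l <= 1 -> A (l * x + (1 - l) * y).

Lemma convex_subset_between A x y z :
  convex_subset A -> A x -> A y -> x <= z <= y -> A z.
Proof.
move=> cA Ax Ay /andP[xz zy]; have [xy|yx] := ltP x y; last first.
  by rewrite (_ : z = x)//; lra.
have yx0 : 0 < y - x by rewrite subr_gt0.
pose l := (y - z) / (y - x).
rewrite (_ : z = l * x + (1 - l) * y); last by rewrite /l; field; lra.
apply: cA => //; rewrite /l divr_ge0 ?subr_ge0//= ?(ltW xy)//.
by rewrite ler_pdivrMr// mul1r lerD2l lerN2.
Qed.

Lemma convex_subset_itvcc A p q : convex_subset A -> A p -> A q ->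
  lbound A p -> ubound A q -> A = `[p, q]%classic.
Proof.
move=> cA Ap Aq lp uq; apply/seteqP; split => x /=; rewrite in_itv/=.
  by move=> Ax; rewrite lp// uq.
exact: convex_subset_between.
Qed.

(** The equation is not divided by [v + w] so that zero weights are covered. *)
Lemma convex_subset_weighted_mean A x y v w :
  convex_subset A -> A x -> A y -> 0 <= v -> 0 <= w ->
  exists2 c, A c & (v + w) * c = v * x + w * y.
Proof.
move=> cA Ax Ay v0 w0; have [vw0|vwN0] := eqVneq (v + w) 0.
  by exists x => //; rewrite (_ : v = 0) 1?(_ : w = 0); [ring|lra|lra].
have vw : 0 < v + w by rewrite lt_neqAle eq_sym vwN0 addr_ge0.
exists (v / (v + w) * x + (1 - v / (v + w)) * y); last by field.
apply: cA => //; rewrite divr_ge0 ?addr_ge0//=.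
by rewrite ler_pdivrMr// mul1r lerDl.
Qed.

Lemma compact_max A : A !=set0 -> compact A -> exists2 q, A q & ubound A q.
Proof.
move=> A0 cA; have [|q] := @compact_EVT_max R R idfun A A0 cA.
  by apply: continuous_subspaceT => x; exact: cvg_id.
rewrite inE => Aq uq; exists q => // x Ax; apply: uq; exact/mem_set.
Qed.

Lemma compact_min A : A !=set0 -> compact A -> exists2 p, A p & lbound A p.
Proof.
move=> [a Aa] cA; have [||_ [p Ap <-] lp] := @compact_max (-%R @` A).
- by exists (- a), a.
- apply: continuous_compact cA; apply: continuous_subspaceT => x.
  by apply: cvgN; exact: cvg_id.
- by exists p => // x Ax; rewrite -lerN2; apply: lp; exists x.
Qed.

End convex_sets.

(** * Summands of families of levels *)

Section summand.
Context {R : realType} (A C B : R -> set R).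
Hypothesis fB : level_family B.
Hypothesis BE : forall r, 0 <= r <= 1 -> B r = [set x + y | x in A r & y in C r].
Hypothesis nA : forall r s, 0 <= r -> r <= s -> s <= 1 -> A s `<=` A r.
Hypothesis nC : forall r s, 0 <= r -> r <= s -> s <= 1 -> C s `<=` C r.
Hypothesis cA : forall r, 0 <= r <= 1 -> convex_subset (A r).

Let B_neq0 r : 0 <= r <= 1 -> B r !=set0.
Proof.
move=> /andP[r0 r1]; have [x Bx] := lf_neq0 fB; exists x.
by apply: lf_antitone Bx.
Qed.

(** The maximum of a sum of two sets is attained at a sum of maxima. *)
Lemma summand_max r : 0 <= r <= 1 ->
  exists x y, [/\ A r x, C r y, ubound (A r) x & ubound (C r) y].
Proof.
move=> r01; have [w] := compact_max (B_neq0 r01) (lf_compact fB r01).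
rewrite BE// => -[x Ax [y Cy <-]] ub; exists x, y; split => // z Az.
  by rewrite -(lerD2r y); apply: ub; exists z => //; exists y.
by rewrite -(lerD2l x); apply: ub; exists x => //; exists z.
Qed.

Lemma summand_min r : 0 <= r <= 1 ->
  exists x y, [/\ A r x, C r y, lbound (A r) x & lbound (C r) y].
Proof.
move=> r01; have [w] := compact_min (B_neq0 r01) (lf_compact fB r01).
rewrite BE// => -[x Ax [y Cy <-]] lb; exists x, y; split => // z Az.
  by rewrite -(lerD2r y); apply: lb; exists z => //; exists y.
by rewrite -(lerD2l x); apply: lb; exists x => //; exists z.
Qed.

Lemma summand_itvcc r : 0 <= r <= 1 -> exists p q, A r = `[p, q]%classic.
Proof.
move=> r01; have [q [_ [Aq _ uq _]]] := summand_max r01.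
have [p [_ [Ap _ lp _]]] := summand_min r01.
by exists p, q; exact: convex_subset_itvcc (cA r01) _ _ _ _.
Qed.

(** Adding to [x] the maximum [q'] of [C r] gives a point of [B s] for all [s < r],
hence of [B r], so that [x + q'] is at most the maximum of [B r], and [x] at most
that of [A r]. The minima give the other bound. *)
Lemma summand_left r x : 0 < r <= 1 ->
  (forall s, 0 < s < r -> A s x) -> A r x.
Proof.
move=> r01 Ax; have /andP[r0 r1] := r01.
have r01' : 0 <= r <= 1 by rewrite ltW.
have Bx y : C r y -> B r (x + y).
  move=> Cy; apply: (lf_left fB) => // s /andP[s0 sr].
  rewrite BE; last by rewrite ltW//= (le_trans (ltW sr)).
  exists x; first by apply: Ax; rewrite s0.
  by exists y => //; apply: nC Cy => //; exact: ltW.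
have [q [q' [Aq Cq uq uq']]] := summand_max r01'.
have [p [p' [Ap Cp lp lp']]] := summand_min r01'.
apply: (convex_subset_between (cA r01') Ap Aq).
move: (Bx _ Cq) (Bx _ Cp); rewrite BE// => -[a Aa [c Cc ac]] [a' Aa' [c' Cc' ac']].
have := uq _ Aa; have := uq' _ Cc; have := lp _ Aa'; have := lp' _ Cc'; lra.
Qed.

(** For the maximum [q'] of [C 0], a point of [B r], [r > 0], close to [x + q'] has
an [A r]-component not much below [x]; the minimum of [C 0] gives a component
not much above [x]. At the smaller of the two levels, convexity yields a point
close to [x]. *)
Lemma summand_zero : A 0 `<=` closure (\bigcup_(r in `]0, 1]%classic) A r).
Proof.
have z01 : 0 <= (0 : R) <= 1 by rewrite lexx ler01.
have [q [q' [Aq Cq uq uq']]] := summand_max z01.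
have [p [p' [Ap Cp lp lp']]] := summand_min z01.
move=> x Ax U /nbhs_ballP[e/= e0 eU].
have approx y : C 0 y -> exists r a c,
    [/\ 0 < r <= 1, A r a, C 0 c & `|x + y - (a + c)| < e].
  move=> Cy; have : B 0 (x + y) by rewrite BE//; exists x => //; exists y.
  move=> /(lf_zero fB)/(_ _ (nbhsx_ballx _ _ e0))[w [[r /=]]].
  rewrite in_itv/= => r01; rewrite BE; last by case/andP: r01 => /ltW ->.
  move=> [a Aa [c Cc <-]] ace; exists r, a, c; split => //.
  by apply: nC Cc => //; case/andP: r01 => // /ltW.
have [r [a [c [r01 Aa Cc]]]] := approx _ Cq.
have [s [b [d [s01 Ab Cd]]]] := approx _ Cp.
rewrite !ltr_norml => /andP[b1 b2] /andP[a1 a2].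
have {}Cc := uq' _ Cc; have {}Cd := lp' _ Cd.
pose t := Num.min r s.
have t0 : 0 < t by rewrite lt_min; case/andP: r01 => ->; case/andP: s01.
have t1 : t <= 1 by rewrite ge_min; case/andP: r01 => _ ->.
have Ata : A t a.
  by apply: nA Aa => //; [exact: ltW|rewrite ge_min lexx|case/andP: r01].
have Atb : A t b.
  by apply: nA Ab => //; [exact: ltW|rewrite ge_min lexx orbT|case/andP: s01].
have near z : A t z -> x - e < z < x + e ->
    \bigcup_(r0 in `]0, 1]%classic) A r0 `&` U !=set0.
  move=> Az /andP[z1 z2]; exists z; split.
    by exists t => //=; rewrite in_itv/= t0.
  by apply: eU; rewrite /ball/= ltr_norml; apply/andP; split; lra.
have [ax|ax] := ltP a (x + e); first by apply: (near a) => //; lra.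
have [bx|bx] := ltP (x - e) b; first by apply: (near b) => //; lra.
apply: (near x); last by lra.
apply: (convex_subset_between _ Atb Ata); last by lra.
by apply: cA; rewrite t1 ltW.
Qed.

Lemma summand_level_family : level_family A.
Proof.
split => //.
- have [z] := lf_neq0 fB; rewrite BE ?ler01 ?lexx// => -[x Ax _].
  by exists x.
- by move=> r x y l r01 Ax Ay; exact: cA.
- by move=> r /summand_itvcc[p [q ->]]; exact: segment_compact.
- exact: summand_left.
- exact: summand_zero.
Qed.

End summand.

Lemma level_endpoints (R : realType) (u : fuzzyNumber R) (r : R) :
  0 <= r <= 1 -> exists p q,
  [/\ level u r = `[p, q]%classic, level u r p & level u r q].
Proof.
move=> /andP[r0 r1]; have ne : level u r !=set0.
  by have [x ux] := level_neq0 u; exists x; exact: level_antitone ux.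
have [q Aq uq] := compact_max ne (level_compact r0).
have [p Ap lp] := compact_min ne (level_compact r0).
exists p, q; split => //; apply: convex_subset_itvcc => // x y l Ax Ay.
exact: level_convex.
Qed.

(** * Stieltjes measures and integrability *)

Section integrable_complements.
Context d (X : measurableType d) (R : realType) (mu : {measure set X -> \bar R}).
Implicit Types (D E : set X) (f g : X -> R).

Lemma integrable_setU D E (f : X -> \bar R) : measurable D -> measurable E ->
  [disjoint D & E] ->
  mu.-integrable D f -> mu.-integrable E f -> mu.-integrable (D `|` E) f.
Proof.
move=> mD mE DE /integrableP[mDf iDf] /integrableP[mEf iEf].
have mf : measurable_fun (D `|` E) f by apply/measurable_funU.
apply/integrableP; split => //; rewrite ge0_integral_setU//.
  exact: lte_add_pinfty.
exact: measurableT_comp.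
Qed.

Lemma integrable_indicW D E : measurable D -> measurable E ->
  (mu E < +oo)%E -> mu.-integrable D (EFin \o (\1_E : X -> R)).
Proof.
move=> mD mE Eoo; apply/integrableP; split.
  by apply/measurable_EFinP; exact: measurable_indic.
rewrite (eq_integral (EFin \o \1_E)); last first.
  by move=> x _; rewrite /= ger0_norm.
rewrite integral_indic//; apply: le_lt_trans Eoo.
by apply: le_measure; rewrite ?inE//; exact: measurableI.
Qed.

Lemma measurable_fun_lt_preimage D f :
  (forall c, measurable (D `&` [set x | f x < c])) -> measurable_fun D f.
Proof.
move=> h mD; apply: (measurability _ (RGenInftyO.measurableE R)) => //.
move=> _ [_ [c ->] <-]; rewrite (_ : _ @^-1` _ = [set x | f x < c])//.
Qed.

Lemma measurable_fun_gt_preimage D f :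
  (forall c, measurable (D `&` [set x | c < f x])) -> measurable_fun D f.
Proof.
move=> h mD; apply: (measurability _ (RGenOInfty.measurableE R)) => //.
move=> _ [_ [c ->] <-]; rewrite (_ : _ @^-1` _ = [set x | c < f x])//.
by apply/seteqP; split => x /=; rewrite in_itv/= andbT.
Qed.

End integrable_complements.

Section completed_stieltjes.
Context {R : realType} (F : cumulative R R).

Lemma caratheodory_closed_itv (C : set R) (i : interval R) : closed C ->
  (wlength F)^*%mu.-cara.-measurable (C `&` [set` i]).
Proof.
move=> cC; apply: sub_caratheodory; apply: measurableI.
  exact: closed_measurable cC.
exact: measurable_itv.
Qed.

Lemma caratheodory_set1 (m : R) : (wlength F)^*%mu.-cara.-measurable [set m].
Proof. by apply: sub_caratheodory; exact: measurable_set1. Qed.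

Lemma completed_stieltjes_set1_lty (m : R) :
  (completed_lebesgue_stieltjes_measure F [set m] < +oo)%E.
Proof.
have mI : (wlength F)^*%mu.-cara.-measurable `]m - 1, m]%classic.
  by apply: sub_caratheodory; exact: measurable_itv.
have := @le_measure _ _ _ (completed_lebesgue_stieltjes_measure F)
  [set m] `]m - 1, m]%classic.
rewrite !inE => /(_ (caratheodory_set1 m) mI) h.
apply: (le_lt_trans (h _)); first by move=> x ->; rewrite /= in_itv/=; lra.
change ((wlength F)^*%mu `](m - 1)%R, m]%classic < +oo)%E.
rewrite measurable_mu_extE; last exact: is_ocitv.
by rewrite /= wlength_itv_bnd ?ltry//; lra.
Qed.

End completed_stieltjes.

(** * Diamond-alpha integrals of real functions *)

Section diamond.
Context {R : realType} (T : timeScale R) (alpha : R).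
Implicit Types (a b m : R) (g h : R -> R).

Lemma measurable_delta_itv (i : interval R) :
  (wlength (forward_jump T))^*%mu.-cara.-measurable (T `&` [set` i]).
Proof. exact/caratheodory_closed_itv/points_closed. Qed.

Lemma measurable_nabla_itv (i : interval R) :
  (wlength (retract_left T))^*%mu.-cara.-measurable (T `&` [set` i]).
Proof. exact/caratheodory_closed_itv/points_closed. Qed.

#[local] Hint Resolve measurable_delta_itv measurable_nabla_itv : core.

Lemma delta_itv_sub a b : T `&` `[a, b[ `<=` ts_itv T a b.
Proof.
move=> t [Tt /=]; rewrite in_itv/= => /andP[at_ tb].
by split => //=; rewrite in_itv/= at_ ltW.
Qed.

Lemma nabla_itv_sub a b : T `&` `]a, b] `<=` ts_itv T a b.
Proof.
move=> t [Tt /=]; rewrite in_itv/= => /andP[at_ tb].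
by split => //=; rewrite in_itv/= ltW.
Qed.

Lemma delta_itv_split a m b : a <= m <= b ->
  T `&` `[a, b[ = (T `&` `[a, m[) `|` (T `&` `[m, b[).
Proof.
move=> /andP[am mb]; rewrite -setIUr; congr (_ `&` _).
by rewrite -itv_bndbnd_setU// bnd_simp.
Qed.

Lemma nabla_itv_split a m b : a <= m <= b ->
  T `&` `]a, b] = (T `&` `]a, m]) `|` (T `&` `]m, b]).
Proof.
move=> /andP[am mb]; rewrite -setIUr; congr (_ `&` _).
by rewrite -itv_bndbnd_setU// bnd_simp.
Qed.

Lemma delta_itv_disj a m b : [disjoint T `&` `[a, m[ & T `&` `[m, b[].
Proof.
apply/disj_setPS => t [[_ /= +] [_ /= +]]; rewrite !in_itv/= => /andP[_ tm].
by rewrite leNgt tm.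
Qed.

Lemma nabla_itv_disj a m b : [disjoint T `&` `]a, m] & T `&` `]m, b]].
Proof.
apply/disj_setPS => t [[_ /= +] [_ /= +]]; rewrite !in_itv/= => /andP[_ tm].
by rewrite ltNge tm.
Qed.

Lemma eq_diamond_integrable a b g h : (forall t, ts_itv T a b t -> g t = h t) ->
  diamond_integrable T a b g -> diamond_integrable T a b h.
Proof.
move=> gh [ig ig']; split.
  apply: eq_integrable ig => // t /set_mem/delta_itv_sub/gh.
  by rewrite /= => ->.
apply: eq_integrable ig' => // t /set_mem/nabla_itv_sub/gh.
by rewrite /= => ->.
Qed.

Lemma eq_diamond_integral a b g h : (forall t, ts_itv T a b t -> g t = h t) ->
  diamond_integral T alpha a b g = diamond_integral T alpha a b h.
Proof.
move=> gh; rewrite /diamond_integral; congr (_ * _ + _ * _);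
  apply: eq_Rintegral => t /set_mem.
- by move/delta_itv_sub/gh.
- by move/nabla_itv_sub/gh.
Qed.

Lemma diamond_integrableD a b g h :
  diamond_integrable T a b g -> diamond_integrable T a b h ->
  diamond_integrable T a b (fun t => g t + h t).
Proof.
move=> [id iv] [jd jv]; split.
  exact: (integrableD (measurable_delta_itv _) id jd).
exact: (integrableD (measurable_nabla_itv _) iv jv).
Qed.

Lemma diamond_integrableZ a b g c :
  diamond_integrable T a b g -> diamond_integrable T a b (fun t => c * g t).
Proof.
move=> [id iv]; split.
  exact: (integrableZl (measurable_delta_itv _) c id).
exact: (integrableZl (measurable_nabla_itv _) c iv).
Qed.

Lemma diamond_integralD a b g h :
  diamond_integrable T a b g -> diamond_integrable T a b h ->
  diamond_integral T alpha a b (fun t => g t + h t) =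
  diamond_integral T alpha a b g + diamond_integral T alpha a b h.
Proof.
by move=> [? ?] [? ?]; rewrite /diamond_integral !RintegralD//; ring.
Qed.

Lemma diamond_integralZ a b g c : diamond_integrable T a b g ->
  diamond_integral T alpha a b (fun t => c * g t) =
  c * diamond_integral T alpha a b g.
Proof.
by move=> [? ?]; rewrite /diamond_integral !RintegralZl//; ring.
Qed.

Lemma diamond_integrable_split a m b g : a <= m <= b ->
  diamond_integrable T a b g <->
  diamond_integrable T a m g /\ diamond_integrable T m b g.
Proof.
move=> amb; rewrite /diamond_integrable (delta_itv_split amb).
rewrite (nabla_itv_split amb); split => [[id iv]|[[id iv] [id' iv']]].
  have mUd := measurableU _ _ (measurable_delta_itv `[a, m[)
    (measurable_delta_itv `[m, b[).
  have mUv := measurableU _ _ (measurable_nabla_itv `]a, m])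
    (measurable_nabla_itv `]m, b]).
  by do 2 split; (apply: integrableS id || apply: integrableS iv).
split; apply: integrable_setU => //.
  exact: delta_itv_disj.
exact: nabla_itv_disj.
Qed.

Lemma diamond_integral_split a m b g : a <= m <= b ->
  diamond_integrable T a b g ->
  diamond_integral T alpha a b g =
  diamond_integral T alpha a m g + diamond_integral T alpha m b g.
Proof.
move=> amb; rewrite /diamond_integrable /diamond_integral.
rewrite (delta_itv_split amb) (nabla_itv_split amb) => -[id iv].
rewrite !Rintegral_setU//; first by ring.
- exact: nabla_itv_disj.
- exact: delta_itv_disj.
Qed.

Lemma diamond_integrable_indic1 a b m :
  diamond_integrable T a b (\1_[set m] : R -> R).
Proof.
split; apply: integrable_indicW => //.
- exact: caratheodory_set1.
- exact: completed_stieltjes_set1_lty.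
- exact: caratheodory_set1.
- exact: completed_stieltjes_set1_lty.
Qed.

Lemma diamond_integral_ge0 a b g : 0 <= alpha <= 1 -> (forall t, 0 <= g t) ->
  0 <= diamond_integral T alpha a b g.
Proof.
move=> /andP[a0 a1] g0; rewrite /diamond_integral.
by rewrite addr_ge0// mulr_ge0// ?subr_ge0//; exact: Rintegral_ge0.
Qed.

End diamond.
#[local] Hint Resolve measurable_delta_itv measurable_nabla_itv : core.

(** * Truncation *)

Section clamp.
Context {R : realType} (p q : R).
Hypothesis pq : p <= q.

Definition clamp (x : R) : R := Num.max p (Num.min x q).

Lemma clamp_itvcc x : p <= clamp x <= q.
Proof. by rewrite /clamp le_max lexx/= ge_max pq ge_min lexx orbT. Qed.

Lemma clamp_dist x y : p <= y <= q -> `|clamp x - y| <= `|x - y|.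
Proof.
move=> /andP[py yq]; rewrite /clamp; case: (leP x q) => xq.
  case: (leP p x) => px //.
  by rewrite ler0_norm ?ler0_norm; lra.
by rewrite max_r// ger0_norm ?ger0_norm; lra.
Qed.

(** If [h = x0 + y0] with [x0] in [[p, q]], the point [h - clamp (h - y)] lies between
[y] and [y0]. *)
Lemma clamp_sub_convex (A : set R) h y x0 y0 : convex_subset A ->
  p <= x0 <= q -> A y -> A y0 -> h = x0 + y0 ->
  A (h - clamp (h - y)).
Proof.
move=> cA /andP[px0 x0q] Ay Ay0 ->; rewrite /clamp.
have Ay' z : (y <= z <= y0) || (y0 <= z <= y) -> A z.
  by case/orP; exact: convex_subset_between.
case: (leP (x0 + y0 - y) q) => hq; last first.
  by rewrite max_r//; apply: Ay'; apply/orP; left; lra.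
case: (leP p (x0 + y0 - y)) => hp; first by rewrite subKr.
by apply: Ay'; apply/orP; right; lra.
Qed.

End clamp.

(** * Measurability for both time-scale measures *)

Section diamond_measurable.
Context {R : realType} (T : timeScale R) (a b : R).
Implicit Types g h : R -> R.

Definition diamond_measurable g : Prop :=
  measurable_fun (T `&` `[a, b[ :
    set (caratheodory_type (wlength (forward_jump T))^*%mu)) g /\
  measurable_fun (T `&` `]a, b] :
    set (caratheodory_type (wlength (retract_left T))^*%mu)) g.

Lemma diamond_integrable_measurable g :
  diamond_integrable T a b g -> diamond_measurable g.
Proof.
move=> [id iv]; split; apply/measurable_EFinP.
  exact: measurable_int id.
exact: measurable_int iv.
Qed.

Lemma le_diamond_integrable g h : diamond_measurable g ->
  (forall t, ts_itv T a b t -> `|g t| <= `|h t|) ->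
  diamond_integrable T a b h -> diamond_integrable T a b g.
Proof.
move=> [md mv] gh [id iv]; split.
  apply: (le_integrable (measurable_delta_itv _ _) _ _ id).
    exact/measurable_EFinP.
  by move=> t /delta_itv_sub/gh; rewrite lee_fin.
apply: (le_integrable (measurable_nabla_itv _ _) _ _ iv).
  exact/measurable_EFinP.
by move=> t /nabla_itv_sub/gh; rewrite lee_fin.
Qed.

Lemma diamond_measurableD g h : diamond_measurable g ->
  diamond_measurable h -> diamond_measurable (fun t => g t + h t).
Proof. by move=> [gd gv] [hd hv]; split; exact: measurable_funD. Qed.

Lemma diamond_measurable_clamp p q g :
  diamond_measurable p -> diamond_measurable q -> diamond_measurable g ->
  diamond_measurable (fun t => clamp (p t) (q t) (g t)).
Proof.
move=> [pd pv] [qd qv] [gd gv]; split.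
  exact: measurable_maxr pd (measurable_minr gd qd).
exact: measurable_maxr pv (measurable_minr gv qv).
Qed.

(** The lower endpoint is less than [c] if and only if the level meets the open
half-line below [c], so Effros measurability gives that of the endpoints. *)
Lemma levels_measurable_endpoints (f : R -> fuzzyNumber R) r :
  0 <= r <= 1 -> levels_measurable T a b f ->
  exists p q, [/\ forall t, p t <= q t,
    forall t, level (f t) r = `[p t, q t]%classic,
    diamond_measurable p & diamond_measurable q].
Proof.
move=> r01 mf.
have /choice[pq h] : forall t, exists pq : R * R,
    [/\ level (f t) r = `[pq.1, pq.2]%classic, level (f t) r pq.1 &
        level (f t) r pq.2].
  by move=> t; have [p [q ?]] := level_endpoints (f t) r01; exists (p, q).
have le t : (pq t).1 <= (pq t).2.
  by have [e + _] := h t; rewrite e /= in_itv/= lexx.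
have below (D : set R) c : D `<=` ts_itv T a b ->
    D `&` [set t | (pq t).1 < c] = D `&`
    [set t | ts_itv T a b t /\ level (f t) r `&` `]-oo, c[%classic !=set0].
  move=> Dab; apply/seteqP; split => t [Dt] /=.
    move=> tc; split => //; split; first exact: Dab.
    by exists (pq t).1; split; [case: (h t)|rewrite /= in_itv].
  move=> [_ [x []]]; have [-> _ _] := h t; rewrite /= !in_itv/=.
  by move=> /andP[px _] xc; split => //; exact: le_lt_trans xc.
have above (D : set R) c : D `<=` ts_itv T a b ->
    D `&` [set t | c < (pq t).2] = D `&`
    [set t | ts_itv T a b t /\ level (f t) r `&` `]c, +oo[%classic !=set0].
  move=> Dab; apply/seteqP; split => t [Dt] /=.
    move=> tc; split => //; split; first exact: Dab.
    by exists (pq t).2; split; [case: (h t)|rewrite /= in_itv/= tc].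
  move=> [_ [x []]]; have [-> _ _] := h t; rewrite /= !in_itv/= andbT.
  by move=> /andP[_ xq] cx; split => //; exact: lt_le_trans xq.
exists (fun t => (pq t).1), (fun t => (pq t).2); split => //.
- by move=> t; case: (h t).
- split; apply: measurable_fun_lt_preimage => c.
    rewrite below; last exact: delta_itv_sub.
    by apply: measurableI => //; case: (mf r `]-oo, c[%classic).
  rewrite below; last exact: nabla_itv_sub.
  by apply: measurableI => //; case: (mf r `]-oo, c[%classic).
- split; apply: measurable_fun_gt_preimage => c.
    rewrite above; last exact: delta_itv_sub.
    by apply: measurableI => //; case: (mf r `]c, +oo[%classic).
  rewrite above; last exact: nabla_itv_sub.
  by apply: measurableI => //; case: (mf r `]c, +oo[%classic).
Qed.

End diamond_measurable.

(** * Integrals of set-valued maps *)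

Section set_diamond_integral.
Context {R : realType} (T : timeScale R) (alpha : R).
Implicit Types (a b m : R) (F G : R -> set R).
Local Notation I := (set_diamond_integral T alpha).

Lemma set_diamond_integral_sub a b F G :
  (forall t, F t `<=` G t) -> I a b F `<=` I a b G.
Proof.
by move=> FG _ [g [sg ig] <-]; exists g => //; split => // t /sg /FG.
Qed.

Lemma set_diamond_integral_convex a b F :
  (forall t, convex_subset (F t)) -> convex_subset (I a b F).
Proof.
move=> cF _ _ l [g [sg ig] <-] [h [sh ih] <-] l01.
exists (fun t => l * g t + (1 - l) * h t).
  split; first by move=> t abt; apply: cF => //; [exact: sg|exact: sh].
  by apply: diamond_integrableD; exact: diamond_integrableZ.
rewrite diamond_integralD ?diamond_integralZ//; exact: diamond_integrableZ.
Qed.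

(** For [k = 0], a selector of the scaled map says nothing about [F], whence the
nonemptiness assumption. *)
Lemma set_diamond_integral_scale a b k F : I a b F !=set0 ->
  I a b (fun t => [set k * x | x in F t]) = [set k * x | x in I a b F].
Proof.
move=> [_ [g0 [sg0 ig0] _]]; apply/seteqP; split; last first.
  move=> _ [_ [g [sg ig] <-] <-]; exists (fun t => k * g t).
    split; last exact: diamond_integrableZ.
    by move=> t /sg Ft; exists (g t).
  by rewrite diamond_integralZ.
move=> _ [h [sh ih] <-]; have [k0|kN0] := eqVneq k 0.
  exists (diamond_integral T alpha a b g0); first by exists g0.
  rewrite -diamond_integralZ//; apply: eq_diamond_integral => t /sh[x _ <-].
  by rewrite k0 !mul0r.
exists (diamond_integral T alpha a b (fun t => k^-1 * h t)).
  exists (fun t => k^-1 * h t) => //; split; last exact: diamond_integrableZ.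
  by move=> t /sh[x Ftx <-]; rewrite mulKf.
by rewrite diamond_integralZ// mulVKf.
Qed.

(** A selector of the sum is decomposed by truncating to [F] its difference with one
fixed integrable selector [psi] of [G]. *)
Lemma set_diamond_integralD a b F G (p q : R -> R) :
  (forall t, p t <= q t) -> (forall t, F t = `[p t, q t]%classic) ->
  diamond_measurable T a b p -> diamond_measurable T a b q ->
  (forall t, convex_subset (G t)) ->
  I a b F !=set0 -> I a b G !=set0 ->
  I a b (fun t => [set x + y | x in F t & y in G t]) =
  [set x + y | x in I a b F & y in I a b G].
Proof.
move=> pq FE mp mq cG [_ [phi [sphi iphi] _]] [_ [psi [spsi ipsi] _]].
apply/seteqP; split; last first.
  move=> _ [_ [g [sg ig] <-] [_ [h [sh ih] <-] <-]].
  exists (fun t => g t + h t); last by rewrite diamond_integralD.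
  split; last exact: diamond_integrableD.
  by move=> t abt; exists (g t); [exact: sg|exists (h t) => //; exact: sh].
move=> _ [h [sh ih] <-].
have iN g : diamond_integrable T a b g -> diamond_integrable T a b (fun t => -1 * g t).
  exact: diamond_integrableZ.
have ihpsi := diamond_integrableD ih (iN _ ipsi).
pose u t := clamp (p t) (q t) (h t + -1 * psi t).
have iu : diamond_integrable T a b u.
  (* [u] is compared with [phi], which takes its values in the same intervals. *)
  have : diamond_integrable T a b (fun t => u t + -1 * phi t).
    apply: le_diamond_integrable (diamond_integrableD ihpsi (iN _ iphi)).
      apply: diamond_measurableD; last exact/diamond_integrable_measurable/iN.
      exact/diamond_measurable_clamp/diamond_integrable_measurable.
    by move=> t /sphi; rewrite FE /= in_itv/= /u !mulN1r; exact: clamp_dist.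
  move=> /diamond_integrableD/(_ iphi); apply: eq_diamond_integrable => t _.
  by rewrite mulN1r subrK.
have iv := diamond_integrableD ih (iN _ iu).
exists (diamond_integral T alpha a b u).
  exists u => //; split => // t _; rewrite FE /= in_itv/=; exact: clamp_itvcc.
exists (diamond_integral T alpha a b (fun t => h t + -1 * u t)).
  exists (fun t => h t + -1 * u t) => //; split => // t abt.
  have [x0 + [y0 Gy0 xy]] := sh _ abt; rewrite FE /= in_itv/= => px0.
  rewrite mulN1r /u mulN1r.
  by apply: (clamp_sub_convex (pq t) (cG t) px0 (spsi _ abt) Gy0).
by rewrite -diamond_integralD//; apply: eq_diamond_integral => t _; ring.
Qed.

(** Two selectors [g], [h] with different values at [m] are both given there the mean
value [c], with weights the diamond integrals of the indicator of [m] over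
the two pieces. Their integrals change by [c - g m] times the first weight and
[c - h m] times the second, and these changes cancel. *)
Lemma set_diamond_integral_split a m b F : 0 <= alpha <= 1 ->
  points T m -> a <= m <= b -> convex_subset (F m) ->
  I a b F = [set x + y | x in I a m F & y in I m b F].
Proof.
move=> alpha01 Tm amb cF; have /andP[am mb] := amb.
apply/seteqP; split.
  move=> _ [g [sg ig] <-]; rewrite (diamond_integral_split _ amb)//.
  have [ig1 ig2] := (diamond_integrable_split T g amb).1 ig.
  exists (diamond_integral T alpha a m g).
    exists g => //; split => // t [Tt /=]; rewrite in_itv/= => /andP[at_ tm].
    by apply: sg; split => //=; rewrite in_itv/= at_ (le_trans tm).
  exists (diamond_integral T alpha m b g) => //.
  exists g => //; split => // t [Tt /=]; rewrite in_itv/= => /andP[mt tb].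
  by apply: sg; split => //=; rewrite in_itv/= tb (le_trans am).
move=> _ [_ [g [sg ig] <-] [_ [h [sh ih] <-] <-]].
set d := \1_[set m] : R -> R.
have d_ge0 t : 0 <= d t by rewrite /d indicE.
have Fg : F m (g m) by apply: sg; split => //=; rewrite in_itv/= am lexx.
have Fh : F m (h m) by apply: sh; split => //=; rewrite in_itv/= mb lexx.
have [c Fc cE] := convex_subset_weighted_mean cF Fg Fh
  (diamond_integral_ge0 T a m alpha01 d_ge0)
  (diamond_integral_ge0 T m b alpha01 d_ge0).
pose u t := if t < m then g t else if m < t then h t else c.
have um : u m = c by rewrite /u ltxx.
pose g' t := g t + (c - g m) * d t.
pose h' t := h t + (c - h m) * d t.
have ug t : ts_itv T a m t -> g' t = u t.
  move=> [_ /=]; rewrite in_itv/= => /andP[_]; rewrite le_eqVlt => /predU1P[->|tm].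
    by rewrite um /g' /d indicE mem_set// mulr1 subrKC.
  rewrite /u tm /g' /d indicE memNset ?mulr0 ?addr0// => tm'.
  by move: tm; rewrite tm' ltxx.
have uh t : ts_itv T m b t -> h' t = u t.
  move=> [_ /=]; rewrite in_itv/= => /andP[+ _]; rewrite le_eqVlt => /predU1P[<-|tm].
    by rewrite um /h' /d indicE mem_set// mulr1 subrKC.
  rewrite /u tm ltNge (ltW tm)/= /h' /d indicE memNset ?mulr0 ?addr0// => tm'.
  by move: tm; rewrite tm' ltxx.
have id a0 b0 k := diamond_integrableZ k (diamond_integrable_indic1 T a0 b0 m).
have ig' := diamond_integrableD ig (id a m (c - g m)).
have ih' := diamond_integrableD ih (id m b (c - h m)).
have iu : diamond_integrable T a b u.
  apply/(diamond_integrable_split T u amb); split.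
    exact: eq_diamond_integrable ig'.
  exact: eq_diamond_integrable ih'.
exists u.
  split => // t [Tt /=]; rewrite in_itv/= => /andP[at_ tb].
  rewrite /u; have [tm|mt|->//] := ltgtP t m.
    by apply: sg; split => //=; rewrite in_itv/= at_ ltW.
  by apply: sh; split => //=; rewrite in_itv/= tb ltW.
rewrite (diamond_integral_split _ amb)//.
rewrite -(eq_diamond_integral alpha ug) -(eq_diamond_integral alpha uh).
rewrite !diamond_integralD// !diamond_integralZ//;
  [|exact: diamond_integrable_indic1..].
move: cE; rewrite -/d; lra.
Qed.

End set_diamond_integral.

(** * Fuzzy integrals *)

Section fuzzy_integral.
Context {R : realType} (T : timeScale R) (alpha : R).
Implicit Types (f g : R -> fuzzyNumber R) (u v w : fuzzyNumber R).

Lemma fuzzy_addC u v : fuzzy_add u v = fuzzy_add v u.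
Proof.
apply: fuzzyNumber_ext => r r01; rewrite !level_add//.
apply/seteqP; split => _ [x ux [y vy <-]]; exists y => //; exists x => //;
  exact: addrC.
Qed.

Lemma convex_subset_level u r : 0 <= r <= 1 -> convex_subset (level u r).
Proof. by move=> /andP[r0 _] x y l ux uy l01; exact: level_convex. Qed.

Lemma fuzzy_integral_neq0 a b f u r : 0 <= r <= 1 ->
  is_fuzzy_integral T alpha a b f u ->
  set_diamond_integral T alpha a b (fun t => level (f t) r) !=set0.
Proof.
move=> r01 fu; rewrite -fu//; have [x ux] := level_neq0 u.
by have /andP[r0 r1] := r01; exists x; exact: level_antitone ux.
Qed.

Lemma is_fuzzy_integralD a b f g u v : levels_measurable T a b f ->
  is_fuzzy_integral T alpha a b f u -> is_fuzzy_integral T alpha a b g v ->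
  is_fuzzy_integral T alpha a b (fun t => fuzzy_add (f t) (g t)) (fuzzy_add u v).
Proof.
move=> mf fu gv r r01; rewrite level_add// fu// gv//.
have [p [q [pq fE mp mq]]] := levels_measurable_endpoints r01 mf.
under [in RHS]eq_fun do rewrite level_add//.
apply/esym/(set_diamond_integralD pq fE mp mq).
- by move=> t; exact: convex_subset_level.
- exact: fuzzy_integral_neq0 fu.
- exact: fuzzy_integral_neq0 gv.
Qed.

Lemma is_fuzzy_integralZ a b k f u : is_fuzzy_integral T alpha a b f u ->
  is_fuzzy_integral T alpha a b (fun t => fuzzy_scale k (f t)) (fuzzy_scale k u).
Proof.
move=> fu r r01; rewrite level_scale// fu//.
under [in RHS]eq_fun do rewrite level_scale//.
apply/esym/set_diamond_integral_scale; exact: fuzzy_integral_neq0 fu.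
Qed.

Lemma is_fuzzy_integral_split a m b f u : 0 <= alpha <= 1 ->
  points T m -> a <= m <= b -> is_fuzzy_integral T alpha a b f u ->
  exists v w, [/\ is_fuzzy_integral T alpha a m f v,
    is_fuzzy_integral T alpha m b f w &
    is_fuzzy_integral T alpha a b f (fuzzy_add v w)].
Proof.
move=> alpha01 Tm amb fu.
pose A c d r := set_diamond_integral T alpha c d (fun t => level (f t) r).
have AE r : 0 <= r <= 1 ->
    A a b r = [set x + y | x in A a m r & y in A m b r].
  move=> r01; apply: set_diamond_integral_split => //.
  exact: convex_subset_level.
have BE r : 0 <= r <= 1 ->
    level u r = [set x + y | x in A a m r & y in A m b r].
  by move=> r01; rewrite fu// -AE.
have BE' r : 0 <= r <= 1 ->
    level u r = [set x + y | x in A m b r & y in A a m r].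
  move=> /BE ->; apply/seteqP; split => _ [x ux [y vy <-]];
    by exists y => //; exists x => //; exact: addrC.
have nA c d r s : 0 <= r -> r <= s -> s <= 1 -> A c d s `<=` A c d r.
  by move=> r0 rs _; apply: set_diamond_integral_sub => t; exact: level_antitone.
have cA c d r : 0 <= r <= 1 -> convex_subset (A c d r).
  move=> r01; apply: set_diamond_integral_convex => t.
  exact: convex_subset_level.
have lA := summand_level_family (level_familyP u) BE
  (nA a m) (nA m b) (cA a m).
have lC := summand_level_family (level_familyP u) BE'
  (nA m b) (nA a m) (cA m b).
exists (fuzzy_of_levels lA), (fuzzy_of_levels lC); split => r r01.
- exact: level_fuzzy_of_levels.
- exact: level_fuzzy_of_levels.
- by rewrite level_add// !level_fuzzy_of_levels// -AE.
Qed.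

End fuzzy_integral.

Theorem theorem8 (R : realType) (T : timeScale R) (alpha s0 s k : R)
    (f g : R -> fuzzyNumber R) :
  0 <= alpha <= 1 -> points T s0 -> points T s -> s0 < s ->
  fuzzy_integrable T alpha s0 s f -> fuzzy_integrable T alpha s0 s g ->
  [/\ (levels_measurable T s0 s f \/ levels_measurable T s0 s g ->
       fuzzy_integrable T alpha s0 s (fun t => fuzzy_add (f t) (g t)) /\
       fuzzy_integral T alpha s0 s (fun t => fuzzy_add (f t) (g t)) =
       fuzzy_add (fuzzy_integral T alpha s0 s f)
                 (fuzzy_integral T alpha s0 s g)),
      fuzzy_integrable T alpha s0 s (fun t => fuzzy_scale k (f t)) /\
      fuzzy_integral T alpha s0 s (fun t => fuzzy_scale k (f t)) =
      fuzzy_scale k (fuzzy_integral T alpha s0 s f) &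
      forall m, ts_itv T s0 s m ->
        [/\ fuzzy_integrable T alpha s0 m f,
            fuzzy_integrable T alpha m s f &
            fuzzy_integral T alpha s0 s f =
            fuzzy_add (fuzzy_integral T alpha s0 m f)
                      (fuzzy_integral T alpha m s f)]].
Proof.
move=> alpha01 _ _ _ [u fu] [v gv].
have [_ fE] := (fuzzy_integralP _ _ _ _ _ _).1 fu.
have [_ gE] := (fuzzy_integralP _ _ _ _ _ _).1 gv.
split.
- move=> mfg; apply/fuzzy_integralP; rewrite fE gE.
  case: mfg => [mf|mg]; first exact: is_fuzzy_integralD.
  under eq_fun do rewrite fuzzy_addC.
  by rewrite fuzzy_addC; exact: is_fuzzy_integralD.
- by apply/fuzzy_integralP; rewrite fE; exact: is_fuzzy_integralZ.
- move=> m [Tm /=]; rewrite in_itv/= => smb.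
  have [v' [w [fv fw fvw]]] := is_fuzzy_integral_split alpha01 Tm smb fu.
  have [iv vE] := (fuzzy_integralP _ _ _ _ _ _).1 fv.
  have [iw wE] := (fuzzy_integralP _ _ _ _ _ _).1 fw.
  have [_ vwE] := (fuzzy_integralP _ _ _ _ _ _).1 fvw.
  by split => //; rewrite vwE vE wE.
Qed.
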